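(* Let $k$ be an algebraically closed field of arbitrary characteristic, let $G$ have type $A_2$ (realized as $G=SL_3(k)$), let $B$ be a Borel subgroup of $G$ (realized as the upper triangular matrices in $G$), and let $\mathfrak{n}$ be the nilradical of the Lie algebra $\mathfrak{b}$ of $B$, i.e. the strictly upper triangular $3\times 3$ matrices, on which $B$ acts by conjugation. Let $x_1=e_{12}$, $x_2=e_{23}$, $x_{12}=e_{13}$ be the basis of root vectors of $\mathfrak{n}$, with corresponding coordinate functions $X_1,X_2,X_{12}$. Then $B$ has exactly five orbits on $\mathfrak{n}$ (in particular $B$ has modality $0$), namely: (1) $B.0=Z(X_1,X_2,X_{12})$, with closure $Z(X_1,X_2,X_{12})$ and dimension $0$; (2) $B.x_{12}=Z(X_1,X_2)\cap V(X_{12})$, with closure $Z(X_1,X_2)$ and dimension $1$; (3) $B.x_1=Z(X_2)\cap V(X_1)$, with closure $Z(X_2)$ and dimension $2$; (4) $B.x_2=Z(X_1)\cap V(X_2)$, with closure $Z(X_1)$ and dimension $2$; (5) $B.(x_1+x_2)=V(X_1,X_2)$, with closure $\mathfrak{n}$ and dimension $3$. The closure ordering on the set of orbits has covering relations $B.0<B.x_{12}$, $B.x_{12}<B.x_1$, $B.x_{12}<B.x_2$, $B.x_1<B.(x_1+x_2)$, $B.x_2<B.(x_1+x_2)$.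
   Context: For polynomial functions on the affine space $\mathfrak{n}$: $Z(f_1,\dots,f_m)$ is the set of common zeros of $f_1,\dots,f_m$ in $\mathfrak{n}$, and $V(g_1,\dots,g_\ell)$ is the set of points of $\mathfrak{n}$ at which every one of $g_1,\dots,g_\ell$ is nonzero. The action of $B$ on $\mathfrak{n}$ is the Adjoint action, $b.x=bxb^{-1}$. Closures and dimensions are with respect to the Zariski topology. The closure ordering is $\mathcal{O}\le\mathcal{O}'$ iff $\mathcal{O}\subseteq\overline{\mathcal{O}'}$. $B$ having modality $0$ on $\mathfrak{n}$ means that the number of $B$-orbits on $\mathfrak{n}$ is finite. Since isogenous groups have the same orbits, a group of type $A_n$ is taken to be $SL_{n+1}(k)$, with $B$ the upper triangular subgroup. $e_{ij}$ is the matrix with $1$ in position $(i,j)$ and $0$ elsewhere. *)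

(* Defs.v *)
From HB Require Import structures.
From mathcomp Require Import all_boot all_order all_algebra.
From mathcomp Require Import boolp classical_sets functions cardinality topology.
From mathcomp Require Import mpoly.

Set Implicit Arguments.
Unset Strict Implicit.
Unset Printing Implicit Defensive.

Import GRing.Theory.
Local Open Scope classical_set_scope.
Local Open Scope ring_scope.

Section Groups.
Variable k : fieldType.

Definition SL3 : {pred 'M[k]_3} := [pred g | \det g == 1].

(* is_trig_mx means lower triangular, hence the transpose. *)
Definition upper_triangular : {pred 'M[k]_3} := [pred g | is_trig_mx g^T].

Record borel := Borel
  { borel_val :> 'M[k]_3; _ : (borel_val \in SL3) && (borel_val \in upper_triangular) }.
HB.instance Definition _ := [isSub for borel_val].

Definition strictly_upper : {pred 'M[k]_3} :=
  [pred x : 'M[k]_3 | [forall i : 'I_3, forall j : 'I_3, (j <= i)%N ==> (x i j == 0)]].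

Lemma strictly_upperP (x : 'M[k]_3) :
  reflect (forall i j : 'I_3, (j <= i)%N -> x i j = 0) (x \in strictly_upper).
Proof.
rewrite inE; apply: (iffP forallP) => [h i j ji|h i].
  by have /forallP/(_ j)/implyP/(_ ji)/eqP := h i.
by apply/forallP => j; apply/implyP => ji; rewrite h.
Qed.

Fact strictly_upper_submod_closed : submod_closed strictly_upper.
Proof.
split=> [|a x y /strictly_upperP hx /strictly_upperP hy]; apply/strictly_upperP => i j ji.
  by rewrite mxE.
by rewrite !mxE hx// hy// mulr0 addr0.
Qed.

HB.instance Definition _ :=
  GRing.isSubmodClosed.Build _ _ strictly_upper strictly_upper_submod_closed.

Record nilrad := Nilrad { nilrad_val :> 'M[k]_3; _ : nilrad_val \in strictly_upper }.
HB.instance Definition _ := [isSub for nilrad_val].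
HB.instance Definition _ := [Choice of nilrad by <:].
HB.instance Definition _ := [SubChoice_isSubZmodule of nilrad by <:].
HB.instance Definition _ := [SubZmodule_isSubLmodule of nilrad by <:].

Lemma Ad_subproof (b : borel) (x : nilrad) :
  b *m x *m invmx b \in strictly_upper.
Proof.
case: b => b /= /andP[/eqP detb /is_trig_mxP trb].
case: x => x /= /strictly_upperP hx.
have bu : b \in unitmx by rewrite unitmxE detb unitr1.
have tb (i j : 'I_3) : (j < i)%N -> b i j = 0.
  by move=> ji; have := trb _ _ ji; rewrite mxE.
have tbT : is_trig_mx b^T by apply/is_trig_mxP => i j ij; rewrite mxE tb.
have diag (i : 'I_3) : b i i != 0.
  apply/eqP => bii; have := oner_neq0 k; rewrite -detb -det_tr (det_trig tbT).
  by rewrite (bigD1 i)//= mxE bii mul0r eqxx.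
set y := _ *m invmx b.
have yb : y *m b = b *m x by rewrite /y mulmxKV.
have bx (i j : 'I_3) : (j <= i)%N -> (b *m x) i j = 0.
  move=> ji; rewrite mxE big1// => l _.
  have [jl|lj] := leqP j l; first by rewrite hx ?mulr0.
  by rewrite tb ?mul0r// (leq_trans lj).
move: y yb => y yb; apply/strictly_upperP.
have col (i j : 'I_3) : (j <= i)%N -> (forall l : 'I_3, (l < j)%N -> y i l = 0) -> y i j = 0.
  move=> ji IH; have := bx i j ji; rewrite -yb mxE (bigD1 j)//= big1 ?addr0.
    by move/eqP; rewrite mulf_eq0 (negPf (diag j)) orbF => /eqP.
  move=> l; rewrite neq_ltn => /orP[lj|jl]; last by rewrite tb ?mulr0.
  by rewrite IH ?mul0r.
suff H n (i j : 'I_3) : (j < n)%N -> (j <= i)%N -> y i j = 0.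
  by move=> i j; exact: (H j.+1).
elim: n i j => // n IH i j jn ji; apply: col => // l lj.
by apply: IH; [exact: leq_trans lj _|exact: ltnW (leq_trans lj ji)].
Qed.

Definition Ad (b : borel) (x : nilrad) : nilrad := Nilrad (Ad_subproof b x).

Definition B_orbit (x : nilrad) : set nilrad := [set Ad b x | b in [set: borel]].

Definition B_orbits : set (set nilrad) := [set B_orbit x | x in [set: nilrad]].

Definition modality_zero : Prop := finite_set B_orbits.

Fact e12_subproof : delta_mx 0 1 \in strictly_upper.
Proof.
by apply/strictly_upperP => -[[|[|[|//]]] ?] -[[|[|[|//]]] ?]; rewrite !mxE.
Qed.
Fact e23_subproof : delta_mx 1 2%:R \in strictly_upper.
Proof.
by apply/strictly_upperP => -[[|[|[|//]]] ?] -[[|[|[|//]]] ?]; rewrite !mxE.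
Qed.
Fact e13_subproof : delta_mx 0 2%:R \in strictly_upper.
Proof.
by apply/strictly_upperP => -[[|[|[|//]]] ?] -[[|[|[|//]]] ?]; rewrite !mxE.
Qed.

(* Matrix indices start at 0, so e_{ij} is delta_mx (i-1) (j-1). *)
Definition x1 : nilrad := Nilrad e12_subproof.
Definition x2 : nilrad := Nilrad e23_subproof.
Definition x12 : nilrad := Nilrad e13_subproof.

Definition X1 : {mpoly k[3]} := 'X_0.
Definition X2 : {mpoly k[3]} := 'X_1.
Definition X12 : {mpoly k[3]} := 'X_2%:R.

(* The coordinates of x in the basis x1, x2, x12. *)
Definition coords (x : nilrad) : 'I_3 -> k :=
  fun i => [tuple x 0 1; x 1 2%:R; x 0 2%:R]`_i.

Definition Z (S : set {mpoly k[3]}) : set nilrad :=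
  [set x | forall f, S f -> f.@[coords x] = 0].

(* All the members of S are nonzero at x, so V S is not the complement of Z S. *)
Definition V (S : set {mpoly k[3]}) : set nilrad :=
  [set x | forall f, S f -> f.@[coords x] != 0].

Definition zariski_open (U : set nilrad) : Prop := exists S, U = ~` Z S.

Fact zariski_openT : zariski_open setT.
Proof.
exists [set 1]; apply/esym/seteqP; split=> // x _ /(_ 1 erefl).
by rewrite meval1 => /eqP; rewrite oner_eq0.
Qed.

Fact zariski_openI : setI_closed zariski_open.
Proof.
move=> _ _ [S ->] [S' ->]; exists [set f * g | f in S & g in S'].
rewrite -setCU; congr (~` _); apply/seteqP; split=> x.
  by case=> h _ [f Sf [g Sg <-]]; rewrite mevalM ?(h f Sf) ?(h g Sg) ?mul0r ?mulr0.
move=> h; apply: contrapT => /not_orP[/existsNP[f /not_implyP[Sf /eqP fx]]].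
move=> /existsNP[g /not_implyP[Sg /eqP gx]].
have /eqP := h (f * g) (ex_intro2 _ _ f Sf (ex_intro2 _ _ g Sg erefl)).
by rewrite mevalM mulf_eq0 (negPf fx) (negPf gx).
Qed.

Fact zariski_open_bigU (I : Type) (U : I -> set nilrad) :
  (forall i, zariski_open (U i)) -> zariski_open (\bigcup_i U i).
Proof.
move=> /choice[S US]; exists (\bigcup_i S i).
rewrite (eq_bigcupr (fun i _ => US i)) -setC_bigcap; congr (~` _).
apply/seteqP; split=> x h.
  by move=> f [i _ Sf]; apply: (h i).
by move=> i _ f Sf; apply: h; exists i.
Qed.

HB.instance Definition _ := isOpenTopological.Build nilrad
  zariski_openT zariski_openI zariski_open_bigU.

Lemma nilrad_closedP (A : set nilrad) : closed A <-> exists S, A = Z S.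
Proof.
rewrite -openC; split=> [[S AS]|[S ->]]; exists S => //.
by rewrite -[A]setCK AS setCK.
Qed.

Definition orbit_le (O O' : set nilrad) : Prop := O `<=` closure O'.
Definition orbit_lt (O O' : set nilrad) : Prop := orbit_le O O' /\ O <> O'.

Definition orbit_covers (O O' : set nilrad) : Prop :=
  [/\ B_orbits O, B_orbits O', orbit_lt O O' &
      ~ exists2 O'', B_orbits O'' & orbit_lt O O'' /\ orbit_lt O'' O'].

End Groups.

Arguments x1 {k}.
Arguments x2 {k}.
Arguments x12 {k}.
Arguments X1 {k}.
Arguments X2 {k}.
Arguments X12 {k}.

Section Dimension.
Variable T : topologicalType.

Definition relatively_closed (A F : set T) : Prop :=
  exists2 C, closed C & F = A `&` C.

Definition irreducible (F : set T) : Prop := F !=set0 /\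
  forall C D, closed C -> closed D -> F `<=` C `|` D -> F `<=` C \/ F `<=` D.

(* F 0 < ... < F n is a chain of irreducible closed subsets of the subspace A. *)
Definition irreducible_chain (A : set T) (n : nat) (F : nat -> set T) : Prop :=
  (forall i, (i <= n)%N -> relatively_closed A (F i) /\ irreducible (F i)) /\
  (forall i, (i < n)%N -> F i `<` F i.+1).

(* The Krull dimension of A, in the subspace topology, is d. *)
Definition has_dim (A : set T) (d : nat) : Prop :=
  (exists F, irreducible_chain A d F) /\
  (forall n F, irreducible_chain A n F -> (n <= d)%N).

End Dimension.

(* Main.v *)
(* The orbit of x is read off from b x = y b, entry by entry: over k it is decided
   by which of the coordinates X1, X2 vanish at x, and by X12 when both do, the
   orbit of x1 + x2 requiring a cube root for the condition det b = 1.  Each orbit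
   is a nonempty open subset of a coordinate subspace, which is irreducible because
   k is infinite, so its closure is that subspace.

   Dimension from below: flats through a point of the orbit parallel to coordinate
   subspaces.  Dimension from above, by growth: if F < F' are irreducible closed
   sets, g vanishes on F but not on F', and the functions u_i are linearly
   independent on F, then the u_i g^j are linearly independent on F'.  So a chain of
   length n yields N^n functions of degree O(N) independent on a subspace of
   dimension d, where there are only O(N^d) monomials of that degree; hence n <= d. *)

Require Import Defs.
From HB Require Import structures.
From mathcomp Require Import all_boot all_order all_algebra.
From mathcomp Require Import boolp classical_sets functions cardinality topology.
From mathcomp Require Import mpoly.
From mathcomp Require Import zify ring.

Set Implicit Arguments.
Unset Strict Implicit.
Unset Printing Implicit Defensive.

Import GRing.Theory.
Local Open Scope classical_set_scope.
Local Open Scope ring_scope.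

(** * Irreducible sets and their open subsets *)

Section Irreducible.
Variable T : topologicalType.

(** Adding the complement of [U] to both members of a closed cover of [F] [&] [U] turns it into a
    closed cover of [F]. *)
Lemma irreducibleI_open (F U : set T) :
  irreducible F -> open U -> F `&` U !=set0 -> irreducible (F `&` U).
Proof.
move=> [_ irrF] oU FU0; split=> // C D cC cD FU.
have cU : closed (~` U) by exact: open_closedC.
have [|||h|h] := irrF (C `|` ~` U) (D `|` ~` U).
- exact: closedU.
- exact: closedU.
- move=> x Fx; have [Ux|nUx] := pselect (U x); last by left; right.
  by have [Cx|Dx] := FU x (conj Fx Ux); [left; left|right; left].
- by left=> x [/h[]].
- by right=> x [/h[]].
Qed.

(** The closure of the trace and the complement of [U] are closed and cover [F]; the latter cannot
    contain [F], so the former does. *)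
Lemma closure_irreducibleI_open (F U : set T) :
  irreducible F -> closed F -> open U -> F `&` U !=set0 ->
  closure (F `&` U) = F.
Proof.
move=> [_ irrF] cF oU [x [Fx Ux]]; apply/seteqP; split.
  by rewrite [X in _ `<=` X](closure_id _).1//; apply: closure_subset => ? [].
have [||y Fy|//|h] := irrF (closure (F `&` U)) (~` U).
- exact: closed_closure.
- exact: open_closedC.
- have [Uy|nUy] := pselect (U y); last by right.
  by left; apply: subset_closure.
- by have := h x Fx.
Qed.

End Irreducible.

(** * Coordinates on the nilradical and irreducibility through polynomials *)

Section Coordinates.
Variable k : fieldType.
Implicit Types (x y : nilrad k) (f g : {mpoly k[3]}).

Lemma coords0 x : coords x 0 = x 0 1. Proof. by []. Qed.
Lemma coords1 x : coords x 1 = x 1 2%:R. Proof. by []. Qed.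
Lemma coords2 x : coords x 2%:R = x 0 2%:R. Proof. by []. Qed.

Lemma ord3_case (P : 'I_3 -> Prop) : P 0 -> P 1 -> P 2%:R -> forall i, P i.
Proof.
move=> P0 P1 P2 [[|[|[|//]]] lt_i3].
- by have -> : Ordinal lt_i3 = 0 by exact: val_inj.
- by have -> : Ordinal lt_i3 = 1 by exact: val_inj.
- by have -> : Ordinal lt_i3 = 2%:R by exact: val_inj.
Qed.

Lemma nilrad_lower x (i j : 'I_3) : (j <= i)%N -> x i j = 0.
Proof. by case: x => x /= /strictly_upperP; apply. Qed.

Definition of_coords (v : 'I_3 -> k) : nilrad k :=
  v 0 *: x1 + v 1 *: x2 + v 2%:R *: x12.

Lemma of_coordsK v : coords (of_coords v) =1 v.
Proof.
by apply: ord3_case; rewrite /coords !mxE /=; rewrite ?(mulr0, mulr1, addr0, add0r).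
Qed.

Lemma coords_zero i : coords (0 : nilrad k) i = 0.
Proof. by move: i; apply: ord3_case; rewrite /coords !mxE. Qed.

Lemma closed_ZP (C : set (nilrad k)) x :
  closed C -> ~ C x -> exists2 f, forall y, C y -> f.@[coords y] = 0 & f.@[coords x] != 0.
Proof.
move=> /nilrad_closedP[S ->] nSx; apply: contrapT => h; apply: nSx => f Sf.
by apply: contrapT => /eqP fx; apply: h; exists f => // y; apply.
Qed.

Lemma closed_zeros f : closed [set x : nilrad k | f.@[coords x] = 0].
Proof.
apply/nilrad_closedP; exists [set f]; apply/seteqP; split=> x /=.
  by move=> fx _ ->.
by apply.
Qed.

(** This is primality of the vanishing ideal of [F]: zero loci are closed, and conversely
    polynomials separate points from closed sets. *)
Lemma irreducible_mpolyP (F : set (nilrad k)) : irreducible F <->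
  F !=set0 /\ forall f g, (exists2 x, F x & f.@[coords x] != 0) ->
    (exists2 x, F x & g.@[coords x] != 0) ->
    exists2 x, F x & (f * g).@[coords x] != 0.
Proof.
split=> -[F0 irrF]; split=> //.
  move=> f g [x Fx fx] [y Fy gy]; apply: contrapT => h.
  have [z Fz||] := irrF _ _ (@closed_zeros f) (@closed_zeros g).
  - have : (f * g).@[coords z] == 0 by apply: contraT => fgz; case: h; exists z.
    by rewrite mevalM mulf_eq0 => /orP[]/eqP; [left|right].
  - by move=> /(_ x Fx)/eqP; rewrite (negPf fx).
  - by move=> /(_ y Fy)/eqP; rewrite (negPf gy).
move=> C D cC cD FCD; apply: contrapT => /not_orP[].
move=> /existsNP[x /not_implyP[Fx nCx]] /existsNP[y /not_implyP[Fy nDy]].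
have [f fC fx] := closed_ZP cC nCx.
have [g gD gy] := closed_ZP cD nDy.
have [||z /FCD[/fC|/gD] e] := irrF f g; [by exists x|by exists y| |];
  by rewrite mevalM e (mulr0, mul0r) eqxx.
Qed.

End Coordinates.

(** * Chains of irreducible closed sets *)

Section UpperBound.
Variable k : fieldType.
Implicit Types (F : set (nilrad k)) (f g : {mpoly k[3]}).

Definition indep_on F (I : finType) (u : I -> {mpoly k[3]}) : Prop :=
  forall c : I -> k,
    (forall x, F x -> (\sum_i c i *: u i).@[coords x] = 0) -> forall i, c i = 0.

Lemma meval_sumZ (I : finType) (c : I -> k) (u : I -> {mpoly k[3]}) v :
  (\sum_i c i *: u i).@[v] = \sum_i c i * (u i).@[v].
Proof. by rewrite raddf_sum; apply: eq_bigr => i _ /=; rewrite mevalZ. Qed.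

(** In a relation on [F'], cancel the lowest power of [g], which irreducibility allows, and restrict
    to [F]: only the terms of lowest exponent remain, and these are independent there. *)
Lemma indep_on_powers F F' (I : finType) (u : I -> {mpoly k[3]}) g N :
  F `<=` F' -> irreducible F' -> indep_on F u ->
  (forall x, F x -> g.@[coords x] = 0) ->
  (exists2 x, F' x & g.@[coords x] != 0) ->
  indep_on F' (fun p : I * 'I_N => u p.1 * g ^+ p.2).
Proof.
move=> FF' /irreducible_mpolyP[_ irr] indF gF gF' c c0.
suff H m : forall j : 'I_N, (j < m)%N -> forall i, c (i, j) = 0.
  by move=> [i j]; exact: (H j.+1).
elim: m => // m IH j; rewrite ltnS leq_eqVlt => /orP[/eqP jm|/IH//].
(* For [n <= m] this is the part of the relation with exponents at least [m], divided by [g ^+ n];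
   by induction [h 0] is the whole relation on [F']. *)
pose h n := \sum_(p : I * 'I_N | (m <= p.2)%N) c p *: (u p.1 * g ^+ (p.2 - n)).
have h0 x : F' x -> (h 0%N).@[coords x] = 0.
  move=> F'x; rewrite -(c0 x F'x) /h; congr (_.@[_]).
  rewrite big_mkcond; apply: eq_bigr => -[i l] _ /=.
  by have [ml|lm] := leqP m l; rewrite ?subn0// IH// scale0r.
have hE : h 0%N = h m * g ^+ m.
  rewrite /h mulr_suml; apply: eq_bigr => -[i l] /= ml.
  by rewrite -scalerAl -mulrA -exprD subnK// subn0.
have hm x : F' x -> (h m).@[coords x] = 0.
  have gm : exists2 x, F' x & (g ^+ m).@[coords x] != 0.
    by case: gF' => y F'y gy; exists y; rewrite // rmorphXn expf_neq0.
  move=> F'x; apply/eqP; apply: contraT => hx.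
  have [|y F'y] := irr (h m) (g ^+ m) _ gm; first by exists x.
  by rewrite -hE h0// eqxx.
(* On [F] all terms of [h m] vanish except those with exponent [m], where the remaining power of [g]
   is 1. *)
apply: indF => x Fx; rewrite -(hm x (FF' x Fx)) meval_sumZ /h raddf_sum /=.
under [RHS]eq_bigr => p _ do rewrite [p in c p]surjective_pairing.
rewrite -(pair_big_dep xpredT (fun (_ : I) (l : 'I_N) => m <= l)%N
  (fun i (l : 'I_N) => (c (i, l) *: (u i * g ^+ (l - m))).@[coords x])) /=.
apply: eq_bigr => i _; rewrite (bigD1 j) ?jm//= big1 ?addr0.
  by rewrite subnn expr0 mulr1 mevalZ.
move=> l /andP[ml lj]; rewrite mevalZ mevalM rmorphXn /= gF// expr0n.
by rewrite subn_eq0 leqNgt ltn_neqAle ml andbT -jm eq_sym val_eqE lj !mulr0.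
Qed.

(** Each step of the chain multiplies the family by the powers of one further polynomial. The slope
    [D] is chosen before [N], so degrees grow only linearly in [N]. *)
Lemma chain_growth (A : set (nilrad k)) n (F : nat -> set (nilrad k)) : irreducible_chain A n F ->
  exists D, forall N, exists (I : finType) (u : I -> {mpoly k[3]}),
    [/\ #|I| = (N ^ n)%N, forall i, (msize (u i) <= (D * N).+1)%N & indep_on (F n) u].
Proof.
elim: n => [|n IHn] [irrF ltF].
  exists 0%N => N; exists unit, (fun=> 1); split=> [|i|c c0 []].
  - by rewrite card_unit.
  - by rewrite msize1.
  - have [_ [[x F0x] _]] := irrF 0%N isT.
    by have := c0 x F0x; rewrite meval_sumZ (bigD1 tt)//= big1 ?addr0 ?meval1 ?mulr1//; case.
have [|D IH] := IHn; first by split=> i lin; [apply: irrF|apply: ltF]; lia.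
have [[C cC FnE] _] := irrF n (leqnSn n).
have [[C' _ FSE] irrFS] := irrF n.+1 (leqnn _).
have [sub /existsNP[x /not_implyP[FSx nFx]]] := ltF n (leqnn _).
(* [F n] is closed only relative to [A]; since [x] lies in [A], it can be separated from the closed
   set [C] itself. *)
have nCx : ~ C x by move=> Cx; apply: nFx; rewrite FnE; split=> //; move: FSx; rewrite FSE => -[].
have [g gC gx] := closed_ZP cC nCx.
(* The powers of [g] have exponent below [N], hence size linear in [N]; the extra 3 absorbs the
   off-by-ones in the size bound for products. *)
exists (D + (msize g).+3)%N => N; have [I [u [cardI szu indu]]] := IH N.
exists (I * 'I_N)%type, (fun p : I * 'I_N => u p.1 * g ^+ p.2); split.
- by rewrite card_prod card_ord cardI expnSr.
- move=> [i j] /=.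
  have sz m : (msize (g ^+ m) <= ((msize g).+1 * m).+1)%N.
    elim: m => [|m IHm]; first by rewrite expr0 msize1.
    rewrite exprS mulnS; apply: leq_trans (msizeM_le _ _) _.
    by rewrite addSn !ltnS -addnS leq_add2l.
  apply: leq_trans (msizeM_le _ _) _; rewrite ltnS.
  apply: leq_trans (leq_add (szu i) (sz j)) _.
  have : (j.+1 * (msize g).+3 <= N * (msize g).+3)%N by rewrite leq_mul2r ltn_ord orbT.
  rewrite mulnDl [((msize g).+3 * N)%N]mulnC; nia.
- apply: (indep_on_powers sub) => //; last by exists x.
  by move=> y; rewrite FnE => -[_ /gC].
Qed.

(** The affine subspace through [a] whose free directions are those in [J]. *)
Definition flat (a : nilrad k) (J : {set 'I_3}) : set (nilrad k) :=
  [set x | forall i, i \notin J -> coords x i = coords a i].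

(** On [flat 0 J] only monomials in the variables of [J] survive, and at most [M ^ #|J|] of them
    have all exponents below [M]. A larger family has a nontrivial combination whose coefficients at
    all these monomials are zero. *)
Lemma indep_on_flat0 (F : set (nilrad k)) (J : {set 'I_3}) (I : finType)
    (u : I -> {mpoly k[3]}) M :
  F `<=` flat 0 J -> (forall i, msize (u i) <= M)%N -> indep_on F u ->
  (#|I| <= M ^ #|J|)%N.
Proof.
move=> FJ szu indu; rewrite leqNgt; apply/negP => lt_card.
pose E := {ffun {i | i \in J} -> 'I_M}.
have cardE : #|{: E}| = (M ^ #|J|)%N by rewrite card_ffun card_ord card_sig.
(* Exponents given on [J] are extended by 0 to the other variables. *)
pose mon (e : E) : 'X_{1..3} :=
  [multinom if insub i is Some s then e s : nat else 0%N | i < 3].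
pose A : 'M[k]_(#|I|, #|{: E}|) := \matrix_(r, s) (u (enum_val r))@_(mon (enum_val s)).
have : kermx A != 0.
  by rewrite -mxrank_eq0 mxrank_ker subn_eq0 -ltnNge (leq_ltn_trans (rank_leq_col _))// cardE.
move=> /rowV0Pn[w /sub_kermxP wA w0].
have cI i : w 0 (enum_rank i) = 0.
  apply: (indu (fun i => w 0 (enum_rank i))) => x /FJ Jx.
  rewrite mevalE big1_seq// => m /andP[_ msupp_m].
  have [off|/forallPn[j]] := boolP [forall j, (j \notin J) ==> (m j == 0%N)]; last first.
    rewrite negb_imply => /andP[jJ mj].
    by rewrite (bigD1 j)//= Jx// coords_zero expr0n (negPf mj) mul0r mulr0.
  have szm : (mdeg m < M)%N.
    apply: leq_trans (msize_mdeg_lt msupp_m) _.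
    apply: leq_trans (msize_sum _ _ _) _.
    apply/bigmax_leqP => l _; exact: leq_trans (msizeZ_le _ _) (szu l).
  have ltm j : (m j < M)%N.
    by apply: leq_ltn_trans szm; rewrite mdegE (bigD1 j)//= leq_addr.
  have -> : m = mon [ffun s => Ordinal (ltm (val s))].
    apply/mnmP => j; rewrite mnmE; case: insubP => [s _ <-|jJ]; first by rewrite ffunE.
    by apply/eqP; have /forallP/(_ j)/implyP := off; apply.
  (* The coefficient of [mon e] in the combination is the entry of [w *m A] at [e]. *)
  set e := [ffun _ => _]; rewrite [X in X * _ = _](_ : _ = 0) ?mul0r//.
  have := congr1 (fun B : 'rV_ _ => B 0 (enum_rank e)) wA; rewrite !mxE => <-.
  rewrite raddf_sum /= (reindex_onto enum_rank enum_val) /=; last by move=> *; exact: enum_valK.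
  apply: eq_big => [l|l _]; first by rewrite enum_rankK eqxx.
  by rewrite !mxE !enum_rankK mcoeffZ.
move/eqP: w0; apply; apply/rowP => r; rewrite mxE.
by rewrite -[r]enum_valK cI.
Qed.

Lemma chain_length (A : set (nilrad k)) (J : {set 'I_3}) n (F : nat -> set (nilrad k)) :
  A `<=` flat 0 J -> irreducible_chain A n F -> (n <= #|J|)%N.
Proof.
move=> AJ chF; have [D grow] := chain_growth chF.
(* If [d < n], this [N] gives [(D * N).+1 ^ d <= (D.+1 * N) ^ d < N ^ d.+1 <= N ^ n], which
   contradicts the count of monomials. *)
rewrite leqNgt; apply/negP => ltn.
set d := #|J|; pose N := (D.+1 ^ d).+1.
have [I [u [cardI szu indu]]] := grow N.
have FJ : F n `<=` flat 0 J.
  case: chF => /(_ n (leqnn n))[[C _ ->] _] _ x [Ax _]; exact: AJ.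
have := indep_on_flat0 FJ szu indu; rewrite cardI; apply/negP; rewrite -ltnNge.
apply: (@leq_ltn_trans ((D.+1 * N) ^ d)).
  have leN : ((D * N).+1 <= D.+1 * N)%N by rewrite mulSn -add1n leq_add2r.
  by case: (posnP #|J|) => [J0|d0]; rewrite /d ?J0// leq_exp2r.
rewrite expnMn; apply: (@leq_trans (N ^ d.+1)); last by rewrite leq_pexp2l.
by rewrite expnS ltn_pmul2r ?expn_gt0.
Qed.

End UpperBound.

(** * Coordinate flats *)

Section Flats.
Variable k : closedFieldType.
Implicit Types (a x y : nilrad k) (J : {set 'I_3}) (f g : {mpoly k[3]}).

Lemma flatS a J J' : J \subset J' -> flat a J `<=` flat a J'.
Proof. by move=> /fintype.subsetP JJ' x Jx i iJ'; apply: Jx; apply: contra iJ' => /JJ'. Qed.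

Lemma flat_closed a J : closed (flat a J).
Proof.
apply/nilrad_closedP.
exists [set 'X_i - (coords a i)%:MP | i in [set i | i \notin J]].
apply/seteqP; split=> x.
  by move=> Jx _ [i /= iJ <-]; rewrite mevalB mevalXU mevalC Jx ?subrr.
move=> Zx i iJ; apply/eqP; rewrite -subr_eq0.
have /eqP := Zx _ (ex_intro2 _ _ i iJ erefl).
by rewrite mevalB mevalXU mevalC.
Qed.

Definition upd (v : 'I_3 -> k) (i : 'I_3) (t : k) : 'I_3 -> k :=
  fun j => if j == i then t else v j.

Lemma upd_id v i : upd v i (v i) =1 v.
Proof. by move=> j; rewrite /upd; case: eqP => [->|]. Qed.

(** Restriction to a coordinate line reduces nonvanishing to univariate polynomials. *)
Lemma line_poly f v i : exists p : {poly k}, forall t, p.[t] = f.@[upd v i t].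
Proof.
exists (\sum_(m <- msupp f) f@_m *: \prod_j (if j == i then 'X else (v j)%:P) ^+ m j).
move=> t; rewrite mevalE horner_sum; apply: eq_bigr => m _.
rewrite hornerZ horner_prod; congr (_ * _); apply: eq_bigr => j _.
by rewrite horner_exp /upd; case: eqP => _; rewrite ?hornerX ?hornerC.
Qed.

(** Points where [f] and [g] respectively do not vanish are merged one coordinate at a time into a
    common point. *)
Lemma flat_irreducible a J : irreducible (flat a J).
Proof.
apply/irreducible_mpolyP; split=> [|f g [x Jx fx] [y Jy gy]]; first by exists a.
have step n : (n <= 3)%N -> exists v w : 'I_3 -> k,
    [/\ forall i, i \notin J -> v i = coords a i /\ w i = coords a i,
        f.@[v] != 0, g.@[w] != 0 & forall i : 'I_3, (i < n)%N -> v i = w i].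
  elim: n => [_|n IHn lt_n3].
    by exists (coords x), (coords y); split=> // i iJ; rewrite Jx// Jy.
  have [v [w [vw fv gw eqvw]]] := IHn (ltnW lt_n3).
  pose i := Ordinal lt_n3.
  have lt_case (j : 'I_3) : (j < n.+1)%N -> j = i \/ (j < n)%N.
    by rewrite ltnS leq_eqVlt => /orP[/eqP ji|]; [left; exact: val_inj|right].
  have [iJ|iJ] := boolP (i \in J); last first.
    exists v, w; split=> // j /lt_case[->|/eqvw//].
    by have [-> ->] := vw i iJ.
  have [p pE] := line_poly f v i; have [q qE] := line_poly g w i.
  have p0 : p != 0.
    apply: contra fv => /eqP p0; rewrite -(meval_eq f (upd_id v i)) -pE p0.
    by rewrite horner0.
  have q0 : q != 0.
    apply: contra gw => /eqP q0; rewrite -(meval_eq g (upd_id w i)) -qE q0.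
    by rewrite horner0.
  (* A common value [t] of the [i]-th coordinate keeps both polynomials nonzero, since over an
     algebraically closed field a nonzero polynomial has a nonroot. *)
  have /closed_nonrootP[t] : p * q != 0 by rewrite mulf_neq0.
  rewrite rootM negb_or /root pE qE => /andP[ft gt].
  exists (upd v i t), (upd w i t); split=> // j; rewrite /upd.
    by move=> jJ; case: eqP => [ji|_]; [rewrite ji iJ in jJ|exact: vw].
  by move=> /lt_case[->|/eqvw->//]; rewrite eqxx.
have [v [w [vw fv gw eqvw]]] := step 3 (leqnn _).
have {}eqvw : w =1 v by move=> i; rewrite eqvw.
exists (of_coords v) => [i iJ|].
  by rewrite of_coordsK; have [] := vw i iJ.
by rewrite (meval_eq _ (of_coordsK v)) mevalM mulf_neq0// -(meval_eq g eqvw).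
Qed.

Lemma closure_flatI_open a J U : open U -> flat a J `&` U !=set0 ->
  closure (flat a J `&` U) = flat a J.
Proof.
exact: (closure_irreducibleI_open (flat_irreducible a J) (@flat_closed a J)).
Qed.

(** Moving [a] by 1 along a direction of [J] outside [J'] stays in the first flat but leaves the
    second. *)
Lemma flat_subset_inv a J J' : flat a J `<=` flat a J' -> J \subset J'.
Proof.
move=> JJ'; apply/fintype.subsetP => i iJ; apply: contraT => iJ'.
have /JJ'/(_ i iJ') : flat a J (of_coords (upd (coords a) i (coords a i + 1))).
  by move=> j jJ; rewrite of_coordsK /upd; case: eqP => // ji; rewrite -ji (negPf jJ) in iJ.
rewrite of_coordsK /upd eqxx => /eqP.
by rewrite -subr_eq0 addrAC subrr add0r oner_eq0.
Qed.

(* The hypothesis [flat 0 J a] says that this flat is a linear subspace. *)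
Lemma has_dim_flatI_open a J U : open U -> U a -> flat 0 J a ->
  has_dim (flat a J `&` U) #|J|.
Proof.
move=> oU Ua a0; split; last first.
  by move=> n F; apply: chain_length => x [Jx _] i iJ; rewrite Jx// a0.
(* The chain consists of the flats through [a] along the first [n] directions of [J], each cut with
   [U]. *)
pose Js n := [set i in take n (enum J)].
have JsJ n : Js n \subset J.
  by apply/fintype.subsetP => i; rewrite inE => /mem_take; rewrite mem_enum.
have flatIE n : (flat a J `&` U) `&` flat a (Js n) = flat a (Js n) `&` U.
  apply/seteqP; split=> x; first by case=> -[].
  by case=> Jnx Ux; do !split=> //; apply: flatS Jnx.
have flat0 n : flat a (Js n) `&` U !=set0 by exists a.
exists (fun n => (flat a J `&` U) `&` flat a (Js n)); split=> n len.
  split; first by exists (flat a (Js n)) => //; exact: flat_closed.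
  by rewrite flatIE; apply: irreducibleI_open; [exact: flat_irreducible|..].
rewrite !flatIE; split=> [|sub].
  apply: setSI; apply: flatS; apply/fintype.subsetP => i; rewrite !inE.
  by apply: mem_subseq; rewrite -(take_takel _ (leqnSn n)); exact: take_subseq.
(* Strictness: both traces on [U] are dense in their flats, so an inclusion of traces passes to the
   flats, against the cardinalities. *)
have : flat a (Js n.+1) `<=` flat a (Js n).
  rewrite -(closure_flatI_open oU (flat0 n)) -(closure_flatI_open oU (flat0 n.+1)).
  exact: closure_subset.
move=> /flat_subset_inv/subset_leq_card.
have uJs m : (m <= #|J|)%N -> #|Js m| = m.
  move=> lem; rewrite cardsE; have /card_uniqP-> := take_uniq m (enum_uniq J).
  by rewrite size_take_min -cardE; apply/minn_idPl.
by rewrite !uJs ?ltnn// ltnW.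
Qed.

End Flats.

(** * Orbits *)

Lemma sum_ord3 (R : nmodType) (F : 'I_3 -> R) : \sum_i F i = F 0 + F 1 + F 2%:R.
Proof.
rewrite !big_ord_recr big_ord0 /= add0r.
by congr (F _ + F _ + F _); apply: val_inj.
Qed.

Lemma prod_ord3 (R : comPzRingType) (F : 'I_3 -> R) : \prod_i F i = F 0 * F 1 * F 2%:R.
Proof.
rewrite !big_ord_recr big_ord0 /= mul1r.
by congr (F _ * F _ * F _); apply: val_inj.
Qed.

Lemma det_upper (R : comPzRingType) (b : 'M[R]_3) :
  is_trig_mx b^T -> \det b = b 0 0 * b 1 1 * b 2%:R 2%:R.
Proof. by move=> trb; rewrite -det_tr det_trig// prod_ord3 !mxE. Qed.

Lemma borel_unitmx (k : fieldType) (b : borel k) : (b : 'M_3) \in unitmx.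
Proof. by case: b => b /= /andP[/eqP detb _]; rewrite unitmxE detb unitr1. Qed.

Lemma nilrad_entries0 (k : fieldType) (x : nilrad k) :
  (x 0 0 = 0) * (x 1 0 = 0) * (x 1 1 = 0)
  * (x 2%:R 0 = 0) * (x 2%:R 1 = 0) * (x 2%:R 2%:R = 0).
Proof. by rewrite !nilrad_lower. Qed.

(* The equation [y = b x b^-1] is solved entrywise in the form [y b = b x]. *)
Lemma B_orbitP (k : fieldType) (x y : nilrad k) : B_orbit x y <->
  exists b0 b1 b2 s t : k,
    [/\ b0 * b1 * b2 = 1, y 0 1 * b1 = b0 * x 0 1,
        y 1 2%:R * b2 = b1 * x 1 2%:R &
        y 0 2%:R * b2 + y 0 1 * t = b0 * x 0 2%:R + s * x 1 2%:R].
Proof.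
split=> [[b _ <-]|[b0 [b1 [b2 [s [t [det1 e01 e12 e02]]]]]]].
  have /matrixP bxE : Ad b x *m b = b *m x by rewrite /= mulmxKV ?borel_unitmx.
  move: (Ad b x) bxE => {}y bxE; case: b bxE => b /= /andP[/eqP detb trb] bxE.
  have low (i j : 'I_3) : (j < i)%N -> b i j = 0.
    by move=> ji; have /is_trig_mxP/(_ _ _ ji) := trb; rewrite mxE.
  have {}low : (b 1 0 = 0) * (b 2%:R 0 = 0) * (b 2%:R 1 = 0) by rewrite !low.
  exists (b 0 0), (b 1 1), (b 2%:R 2%:R), (b 0 1), (b 1 2%:R); split.
  - by rewrite -det_upper.
  - have := bxE 0 1; rewrite !mxE !sum_ord3 !(nilrad_entries0, low).
    by rewrite !(mul0r, mulr0, addr0, add0r).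
  - have := bxE 1 2%:R; rewrite !mxE !sum_ord3 !(nilrad_entries0, low).
    by rewrite !(mul0r, mulr0, addr0, add0r).
  - have := bxE 0 2%:R; rewrite !mxE !sum_ord3 !(nilrad_entries0, low).
    by rewrite !(mul0r, mulr0, addr0, add0r) => <-; rewrite addrC.
(* The corner entry of [b] only ever meets zero entries of [x] and [y], so 0 is as good as any
   value. *)
pose b : 'M[k]_3 := \matrix_(i, j)
  (nth [::] [:: [:: b0; s; 0]; [:: 0; b1; t]; [:: 0; 0; b2]] i)`_j.
have trb : is_trig_mx b^T.
  by apply/is_trig_mxP; apply: ord3_case; apply: ord3_case => //= _; rewrite !mxE.
have b_borel : (b \in @SL3 k) && (b \in @upper_triangular k).
  by rewrite !inE trb andbT det_upper// !mxE /= det1.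
exists (Borel b_borel) => //; apply: val_inj => /=.
suff <- : y *m b = b *m x by rewrite mulmxK// (borel_unitmx (Borel b_borel)).
apply/matrixP; apply: ord3_case; apply: ord3_case; rewrite !mxE !sum_ord3 !mxE /=;
  rewrite !nilrad_entries0 !(mul0r, mulr0, addr0, add0r)//.
by rewrite addrC e02.
Qed.

(* The position of the orbit of x in the list 0, x12, x1, x2, x1 + x2. *)
Definition orbit_index (k : fieldType) (x : nilrad k) : nat :=
  if x 0 1 == 0 then if x 1 2%:R == 0 then x 0 2%:R != 0 : nat else 3
  else if x 1 2%:R == 0 then 2 else 4.

(** One root suffices, so separability is irrelevant and characteristic 3 is covered. *)
Lemma cube_root (k : closedFieldType) (c : k) : exists t, t ^+ 3 = c.
Proof.
have /closed_rootP[t] : size ('X^3 - c%:P) != 1 by rewrite size_XnsubC.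
by rewrite rootE !hornerE subr_eq0 => /eqP; exists t.
Qed.

Lemma B_orbitE (k : closedFieldType) (x : nilrad k) :
  B_orbit x = [set y | orbit_index y = orbit_index x].
Proof.
apply/seteqP; split=> y /=; rewrite B_orbitP /orbit_index.
  move=> [b0 [b1 [b2 [s [t [det1 e01 e12 e02]]]]]].
  have : b0 * b1 * b2 != 0 by rewrite det1 oner_neq0.
  rewrite !mulf_eq0 !negb_or => /andP[/andP[/negPf nb0 /negPf nb1] /negPf nb2].
  have := congr1 (eq_op^~ 0) e01; rewrite !mulf_eq0 nb0 nb1 orbF /= => ->.
  have := congr1 (eq_op^~ 0) e12; rewrite !mulf_eq0 nb1 nb2 orbF /= => y12.
  rewrite y12; case: ifP => // /eqP x01; case: ifP => // /eqP x12.
  move/eqP: e01; rewrite x01 mulr0 mulf_eq0 nb1 orbF => /eqP y01.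
  have := congr1 (eq_op^~ 0) e02.
  by rewrite x12 y01 mul0r mulr0 !addr0 !mulf_eq0 nb0 nb2 orbF /= => ->.
(* Equal indices force the same vanishing pattern of X1 and X2 at [x] and [y], which leaves four
   cases. *)
have [x01|x01] := eqVneq (x 0 1) 0; have [x12|x12] := eqVneq (x 1 2%:R) 0;
  have [y01|y01] := eqVneq (y 0 1) 0; have [y12|y12] := eqVneq (y 1 2%:R) 0;
  try by [|case: eqP].
- rewrite x01 x12 y01 y12.
  have [->|x02] := eqVneq (x 0 2%:R) 0; have [->|y02] // := eqVneq (y 0 2%:R) 0 => _.
    by exists 1, 1, 1, 0, 0; split; ring.
  (* A diagonal matrix of determinant 1 rescales X12. *)
  by exists (y 0 2%:R / x 0 2%:R), (x 0 2%:R / y 0 2%:R), 1, 0, 0; split; field; rewrite ?x02 ?y02.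
- rewrite x01 y01 => _.
  (* The diagonal matches X2, and [s] is then solved from the equation for X12; in the next case [t]
     plays this part for X1. *)
  exists (x 1 2%:R / y 1 2%:R), (y 1 2%:R / x 1 2%:R), 1.
  exists ((y 0 2%:R - x 1 2%:R / y 1 2%:R * x 0 2%:R) / x 1 2%:R), 0.
  by split; field; rewrite ?x12 ?y12.
- rewrite x12 y12 => _.
  exists (y 0 1 / x 0 1), 1, (x 0 1 / y 0 1), 0.
  exists ((y 0 1 / x 0 1 * x 0 2%:R - y 0 2%:R * (x 0 1 / y 0 1)) / y 0 1).
  by split; field; rewrite ?x01 ?y01.
(* X1 and X2 fix the ratios [b0 / b1] and [b1 / b2]; determinant 1 then prescribes the cube of [b2],
   taken to be [t]. *)
move=> _; have [t tE] := cube_root (x 0 1 / y 0 1 * (x 1 2%:R / y 1 2%:R) ^+ 2).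
exists (y 0 1 / x 0 1 * (y 1 2%:R / x 1 2%:R) * t), (y 1 2%:R / x 1 2%:R * t), t.
exists ((y 0 2%:R * t - y 0 1 / x 0 1 * (y 1 2%:R / x 1 2%:R) * t * x 0 2%:R) / x 1 2%:R), 0.
split; [|by field; rewrite ?x01 ?x12 ..].
transitivity (y 0 1 / x 0 1 * (y 1 2%:R / x 1 2%:R) ^+ 2 * t ^+ 3); first by ring.
by rewrite tE; field; rewrite ?x01 ?x12 ?y01 ?y12.
Qed.

(** * The five orbits: equations, closures, dimensions and closure order *)

Section Strata.
Variable k : closedFieldType.
Implicit Types x y : nilrad k.

Definition orbit_rep (n : nat) : nilrad k := nth 0 [:: 0; x12; x1; x2; x1 + x2] n.

(* The n-th orbit is the open subset [free_mpoly n <> 0] of the coordinate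
   subspace spanned by the coordinates in [free_coords n]. *)
Definition free_coords (n : nat) : seq nat :=
  nth [::] [:: [::]; [:: 2]; [:: 0; 2]; [:: 1; 2]; [:: 0; 1; 2]]%N n.
Definition free_set (n : nat) : {set 'I_3} := [set i : 'I_3 | (i : nat) \in free_coords n].
Definition free_mpoly (n : nat) : {mpoly k[3]} := nth 1 [:: 1; X12; X1; X2; X1 * X2] n.

Lemma lt5_case (P : nat -> Prop) :
  P 0%N -> P 1%N -> P 2%N -> P 3%N -> P 4%N -> forall n, (n < 5)%N -> P n.
Proof. by move=> ? ? ? ? ? [|[|[|[|[|n]]]]]. Qed.

Lemma card_free_set n : (n < 5)%N -> #|free_set n| = size (free_coords n).
Proof.
by move: n; apply: lt5_case; rewrite /free_set -sum1_card big_mkcond /= sum_ord3 !inE.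
Qed.

Lemma orbit_index_lt5 x : (orbit_index x < 5)%N.
Proof. by rewrite /orbit_index; do 3?case: ifP => // _; case: eqP. Qed.

Lemma orbit_index_rep n : (n < 5)%N -> orbit_index (orbit_rep n) = n.
Proof.
move: n; apply: lt5_case; rewrite /orbit_index /orbit_rep /= !mxE /=;
  by rewrite ?addr0 ?add0r ?eqxx ?oner_eq0.
Qed.

Lemma flat0E (J : {set 'I_3}) x : flat 0 J x <->
  [&& (x 0 1 == 0) || (0 \in J), (x 1 2%:R == 0) || (1 \in J)
    & (x 0 2%:R == 0) || (2%:R \in J)].
Proof.
rewrite -coords0 -coords1 -coords2; split=> [Jx|/and3P[h0 h1 h2]].
  by apply/and3P; split; (case: (boolP (_ \in J)) => iJ; [rewrite orbT|]);
    rewrite ?orbT// Jx// coords_zero eqxx.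
by apply: ord3_case => iJ; rewrite coords_zero; apply/eqP;
  [move: h0|move: h1|move: h2]; rewrite (negPf iJ) orbF.
Qed.

(** Both sides depend only on which of the three coordinates vanish, so eight cases decide the
    equality. *)
Lemma B_orbit_repE n : (n < 5)%N ->
  B_orbit (orbit_rep n) = flat 0 (free_set n) `&` [set x | (free_mpoly n).@[coords x] != 0].
Proof.
move=> lt_n5; rewrite B_orbitE orbit_index_rep//; apply/seteqP.
suff H x : orbit_index x = n <->
    flat 0 (free_set n) x /\ (free_mpoly n).@[coords x] != 0.
  by split=> x /H.
rewrite flat0E /orbit_index (rwP andP); move: n lt_n5; apply: lt5_case; rewrite !inE /=;
  rewrite ?mevalM ?meval1 ?mevalXU ?oner_eq0 ?coords0 ?coords1 ?coords2 ?mulf_eq0;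
  by case: (x 0 1 == 0); case: (x 1 2%:R == 0); case: (x 0 2%:R == 0).
Qed.

Lemma free_open n : open [set x | (free_mpoly n).@[coords x] != 0].
Proof.
have := closed_openC (@closed_zeros k (free_mpoly n)).
by congr open; apply/seteqP; split=> x /eqP.
Qed.

(** The dimension count needs the flat based at a point of the orbit; the origin lies outside every
    orbit but the first. *)
Lemma orbit_rep_flat n : (n < 5)%N ->
  [/\ flat 0 (free_set n) (orbit_rep n),
      (free_mpoly n).@[coords (orbit_rep n)] != 0 &
      flat (orbit_rep n) (free_set n) = flat 0 (free_set n)].
Proof.
move=> lt_n5; have : B_orbit (orbit_rep n) (orbit_rep n) by rewrite B_orbitE.
rewrite B_orbit_repE// => -[rep0 ?]; split=> //.
by apply/seteqP; split=> x Jx i iJ; rewrite Jx// rep0.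
Qed.

Lemma closure_B_orbit n : (n < 5)%N ->
  closure (B_orbit (orbit_rep n)) = flat 0 (free_set n).
Proof.
move=> lt_n5; rewrite B_orbit_repE//; apply: closure_flatI_open; first exact: free_open.
by have [? ? _] := orbit_rep_flat lt_n5; exists (orbit_rep n).
Qed.

Lemma has_dim_B_orbit n : (n < 5)%N ->
  has_dim (B_orbit (orbit_rep n)) (size (free_coords n)).
Proof.
move=> lt_n5; have [? ? rep0] := orbit_rep_flat lt_n5.
rewrite B_orbit_repE// -card_free_set// -rep0.
by apply: has_dim_flatI_open => //; exact: free_open.
Qed.

Lemma B_orbit_rep_inj m n : (m < 5)%N -> (n < 5)%N ->
  B_orbit (orbit_rep m) = B_orbit (orbit_rep n) -> m = n.
Proof.
move=> lt_m5 lt_n5 /(congr1 (@^~ (orbit_rep m))); rewrite !B_orbitE /= !orbit_index_rep//.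
by move=> <-.
Qed.

Lemma B_orbits_rep : @B_orbits k = [set B_orbit (orbit_rep n) | n in `I_5].
Proof.
apply/seteqP; split=> [_ [x _ <-]|_ [n _ <-]]; last by exists (orbit_rep n).
exists (orbit_index x); first exact: orbit_index_lt5.
by rewrite !B_orbitE orbit_index_rep ?orbit_index_lt5.
Qed.

Lemma card_B_orbits : (@B_orbits k #= `I_5)%card.
Proof.
rewrite B_orbits_rep; apply: inj_card_eq => m n; rewrite !inE.
exact: B_orbit_rep_inj.
Qed.

(** An orbit lies in a closed flat exactly when its closure does, so the order is inclusion of the
    coordinate subspaces. *)
Lemma orbit_le_rep m n : (m < 5)%N -> (n < 5)%N ->
  orbit_le (B_orbit (orbit_rep m)) (B_orbit (orbit_rep n)) <->
  all (mem (free_coords n)) (free_coords m).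
Proof.
move=> lt_m5 lt_n5; rewrite /orbit_le closure_B_orbit//.
transitivity (free_set m \subset free_set n).
  split=> [le_mn|/(@flatS k 0) sub].
    apply: (@flat_subset_inv k 0); rewrite -(closure_B_orbit lt_m5).
    rewrite [X in _ `<=` X](closure_id _).1; first exact: closure_subset.
    exact: flat_closed.
  by apply: subset_trans sub; rewrite -closure_B_orbit//; exact: subset_closure.
have free_lt3 : all (gtn 3) (free_coords m) by move: m lt_m5; apply: lt5_case.
split=> [/fintype.subsetP sub|/allP sub].
  apply/allP => i im; have lt_i3 : (i < 3)%N := allP free_lt3 i im.
  by have := sub (Ordinal lt_i3); rewrite !inE; apply.
by apply/fintype.subsetP => i; rewrite !inE => /sub.
Qed.

Definition rep_lt (m n : nat) : bool :=
  (m != n) && all (mem (free_coords n)) (free_coords m).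

Lemma orbit_lt_rep m n : (m < 5)%N -> (n < 5)%N ->
  orbit_lt (B_orbit (orbit_rep m)) (B_orbit (orbit_rep n)) <-> rep_lt m n.
Proof.
move=> lt_m5 lt_n5; rewrite /orbit_lt orbit_le_rep// /rep_lt; split.
  by move=> [-> mn]; rewrite andbT; apply/eqP => e; apply: mn; rewrite e.
by move=> /andP[/eqP mn ->]; split=> // /B_orbit_rep_inj e; apply: mn; apply: e.
Qed.

(** This makes covering a boolean condition on indices, decidable by computation. *)
Lemma orbit_covers_rep (O O' : set (nilrad k)) : orbit_covers O O' <->
  exists m n, [/\ (m < 5)%N, (n < 5)%N, O = B_orbit (orbit_rep m),
    O' = B_orbit (orbit_rep n) &
    rep_lt m n && ~~ has (fun l => rep_lt m l && rep_lt l n) (iota 0 5)].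
Proof.
rewrite /orbit_covers B_orbits_rep; split.
  move=> [[m lt_m5 <-] [n lt_n5 <-] /(orbit_lt_rep lt_m5 lt_n5) mn noO].
  exists m, n; split; rewrite ?mn//.
  apply/hasPn => l; rewrite mem_iota add0n => /= lt_l5; apply/negP => /andP[ml ln].
  by apply: noO; exists (B_orbit (orbit_rep l)); [exists l|split; exact/orbit_lt_rep].
move=> [m [n [lt_m5 lt_n5 -> -> /andP[mn /hasPn no]]]]; split.
- by exists m.
- by exists n.
- exact/orbit_lt_rep.
- move=> [_ [l lt_l5 <-] [/(orbit_lt_rep lt_m5 lt_l5) ml /(orbit_lt_rep lt_l5 lt_n5) ln]].
  by have := no l; rewrite mem_iota ml ln => /(_ lt_l5).
Qed.

Lemma ZU (S S' : set {mpoly k[3]}) : Z (S `|` S') = Z S `&` Z S'.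
Proof.
apply/seteqP; split=> x.
  by move=> h; split=> f Sf; apply: h; [left|right].
by move=> [h h'] f [/h|/h'].
Qed.

Lemma VU (S S' : set {mpoly k[3]}) : V (S `|` S') = V S `&` V S'.
Proof.
apply/seteqP; split=> x.
  by move=> h; split=> f Sf; apply: h; [left|right].
by move=> [h h'] f [/h|/h'].
Qed.

Lemma Z1 f : Z [set f] = [set x : nilrad k | f.@[coords x] == 0].
Proof. by apply/seteqP; split=> x /= h; [apply/eqP; exact: h|move=> _ ->; apply/eqP]. Qed.

Lemma V1 f : V [set f] = [set x : nilrad k | f.@[coords x] != 0].
Proof. by apply/seteqP; split=> x /= h; [exact: h|move=> _ ->]. Qed.

End Strata.


Theorem proposition4 (k : closedFieldType) :
  (@B_orbits k = [set B_orbit 0; B_orbit x12; B_orbit x1; B_orbit x2; B_orbit (x1 + x2)]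
   /\ (@B_orbits k #= `I_5)%card)
  /\ modality_zero k
  /\ [/\ B_orbit (0 : nilrad k) = Z [set X1; X2; X12],
         closure (B_orbit (0 : nilrad k)) = Z [set X1; X2; X12]
       & has_dim (B_orbit (0 : nilrad k)) 0]
  /\ [/\ B_orbit (x12 : nilrad k) = Z [set X1; X2] `&` V [set X12],
         closure (B_orbit (x12 : nilrad k)) = Z [set X1; X2]
       & has_dim (B_orbit (x12 : nilrad k)) 1]
  /\ [/\ B_orbit (x1 : nilrad k) = Z [set X2] `&` V [set X1],
         closure (B_orbit (x1 : nilrad k)) = Z [set X2]
       & has_dim (B_orbit (x1 : nilrad k)) 2]
  /\ [/\ B_orbit (x2 : nilrad k) = Z [set X1] `&` V [set X2],
         closure (B_orbit (x2 : nilrad k)) = Z [set X1]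
       & has_dim (B_orbit (x2 : nilrad k)) 2]
  /\ [/\ B_orbit (x1 + x2 : nilrad k) = V [set X1; X2],
         closure (B_orbit (x1 + x2 : nilrad k)) = [set: nilrad k]
       & has_dim (B_orbit (x1 + x2 : nilrad k)) 3]
  /\ forall O O' : set (nilrad k), orbit_covers O O' <->
       [\/ O = B_orbit 0 /\ O' = B_orbit x12,
           O = B_orbit x12 /\ O' = B_orbit x1,
           O = B_orbit x12 /\ O' = B_orbit x2
         | (O = B_orbit x1 /\ O' = B_orbit (x1 + x2))
           \/ (O = B_orbit x2 /\ O' = B_orbit (x1 + x2))].
Proof.
(* All five descriptions reduce to rewriting a flat and its open part in terms of [Z] and [V]. *)
have orbit n (lt_n5 : (n < 5)%N) (F A : set (nilrad k)) :
    flat 0 (free_set n) = F ->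
    F `&` [set x | (free_mpoly k n).@[coords x] != 0] = A ->
    [/\ B_orbit (orbit_rep k n) = A, closure (B_orbit (orbit_rep k n)) = F
       & has_dim (B_orbit (orbit_rep k n)) (size (free_coords n))].
  by move=> <- <-; split; [exact: B_orbit_repE|exact: closure_B_orbit|exact: has_dim_B_orbit].
split; first (split; last exact: card_B_orbits).
  rewrite B_orbits_rep; apply/seteqP; split=> [_ [n lt_n5 <-]|O].
    by move: n lt_n5; apply: lt5_case; rewrite /orbit_rep /=; tauto.
  by case=> [[[[]|]|]|] ->; [exists 0%N|exists 1%N|exists 2%N|exists 3%N|exists 4%N].
split; first by apply/finite_setP; exists 5%N; exact: card_B_orbits.
have eqset (A B : set (nilrad k)) : (forall x, A x <-> B x) -> A = B.
  by move=> AB; apply/seteqP; split=> x /AB.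
split; [|split; [|split; [|split; [|split]]]];
  [apply: (@orbit 0%N)|apply: (@orbit 1%N)|apply: (@orbit 2)|apply: (@orbit 3)
  |apply: (@orbit 4)|move=> O O'; rewrite orbit_covers_rep] => //;
  try (apply: eqset => x; rewrite ?(ZU, VU, Z1, V1) /= ?flat0E ?inE /= ?mevalM
         ?mevalXU ?meval1 ?coords0 ?coords1 ?coords2 ?mulf_eq0 ?oner_eq0;
       case: (x 0 1 == 0); case: (x 1 2%:R == 0); case: (x 0 2%:R == 0) => /=; intuition).
split=> [[m [n [lt_m5 lt_n5 -> ->]]]|].
  (* Evaluating the covering condition on the 25 index pairs leaves five. *)
  move: m lt_m5; apply: lt5_case; move: n lt_n5; apply: lt5_case => //= _.
  - by constructor 1.
  - by constructor 2.
  - by constructor 3.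
  - by constructor 4; left.
  - by constructor 4; right.
case=> [[-> ->]|[-> ->]|[-> ->]|[[-> ->]|[-> ->]]].
- by exists 0%N, 1%N.
- by exists 1%N, 2%N.
- by exists 1%N, 3%N.
- by exists 2%N, 4%N.
- by exists 3%N, 4%N.
Qed.
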